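(* Let $d \geq 1$ and let $\mathcal{B} = \{B_1, \dots, B_n\}$ be a $(2,3)$-agreeable arrangement of $n \geq 1$ $d$-boxes. Then some point of $\mathbb{R}^d$ lies in at least $n/(2d)$ of the boxes, i.e. the agreement proportion of $\mathcal{B}$ is at least $(2d)^{-1}$. Equivalently, in graph form: for all integers $r \geq 1$ and $d \geq 1$, $\rho(r,d) \geq \frac{1}{2d}$.
   Context: A $d$-box is a Cartesian product of $d$ closed intervals in $\mathbb{R}^d$. An arrangement of boxes is $(2,3)$-agreeable if among any three of its boxes at least two have non-empty intersection. The agreement proportion of an arrangement of $n$ boxes is (maximal number of boxes sharing a common point)$/n$. The intersection graph of an arrangement has one vertex per box and an edge between two boxes iff they intersect. The boxicity $\mathrm{box}(G)$ of a simple graph $G$ is the smallest $d$ such that $G$ is the intersection graph of an arrangement of $d$-boxes, with the convention $\mathrm{box}(K_n)=0$. A graph is $(2,3)$-agreeable if any three vertices induce a subgraph with at least one edge. $\omega(G)$ denotes the clique number. $\mathcal{G}_d(r)$ is the set of $(2,3)$-agreeable graphs $G$ with $\mathrm{box}(G)\le d$ and $\omega(G)\le r$, and $\rho(r,d)=\min\{\omega(G)/\#V(G) : G \in \mathcal{G}_d(r)\}$ (the minimum over finitely many graphs, graphs with at least one vertex). *)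

(* Defs.v *)
From mathcomp Require Import all_boot all_order all_algebra.
From mathcomp Require Import all_classical all_reals.

Set Implicit Arguments.
Unset Strict Implicit.
Unset Printing Implicit Defensive.

Import Order.TTheory GRing.Theory Num.Theory.

Local Open Scope classical_set_scope.
Local Open Scope ring_scope.

(* The condition [a 0 i <= b 0 i] excludes the empty interval. For [d = 0] the
   only box is the one-point space ['rV_0]. *)
Definition is_box (R : realType) (d : nat) (A : set 'rV[R]_d) : Prop :=
  exists a b : 'rV[R]_d, (forall i, a 0 i <= b 0 i) /\
    A = [set x : 'rV[R]_d | forall i, x 0 i \in `[a 0 i, b 0 i]].

(* Arrangements are finite families, so a box may be repeated. *)
Definition box_arrangement (R : realType) (d : nat) (I : finType)
  (B : I -> set 'rV[R]_d) : Prop := forall i, is_box (B i).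

Definition arrangement_agreeable23 (T : Type) (I : finType) (B : I -> set T) :
  Prop :=
  forall i j k : I, i != j -> i != k -> j != k ->
    [\/ B i `&` B j !=set0, B i `&` B k !=set0 | B j `&` B k !=set0].

Definition point_depth (T : Type) (I : finType) (B : I -> set T) (x : T) : nat :=
  #|[pred i | x \in B i]|.

Definition agreement_number (T : Type) (I : finType) (B : I -> set T) : nat :=
  \max_(S : {set I} | `[< exists x, forall i, i \in S -> B i x >]) #|S|.

Definition agreement_proportion (R : realType) (d : nat) (I : finType)
  (B : I -> set 'rV[R]_d) : R := (agreement_number B)%:R / #|I|%:R.

Record sgraph := SGraph {
  vertex :> finType;
  adj : rel vertex;
  adj_sym : symmetric adj;
  adj_irr : irreflexive adj }.

Section IntersectionGraph.
Variables (T : Type) (I : finType) (B : I -> set T).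

Definition inter_adj : rel I :=
  fun i j => (i != j) && `[< B i `&` B j !=set0 >].

Lemma inter_adj_sym : symmetric inter_adj.
Proof. by move=> i j; rewrite /inter_adj eq_sym setIC. Qed.

Lemma inter_adj_irr : irreflexive inter_adj.
Proof. by move=> i; rewrite /inter_adj eqxx. Qed.

Definition intersection_graph : sgraph := SGraph inter_adj_sym inter_adj_irr.

End IntersectionGraph.

(* The boxes are indexed by the vertices of [G], which absorbs the graph
   isomorphism. *)
Definition box_representable (R : realType) (d : nat) (G : sgraph) : Prop :=
  exists B : G -> set 'rV[R]_d,
    box_arrangement B /\ @adj G =2 @adj (intersection_graph B).

Lemma box_representable_ex (R : realType) (G : sgraph) :
  exists d, `[< box_representable R d G >].
Proof.
exists #|G|; apply/asboolP.
pose lo (u v : G) : R := if (u == v) || adj v u then 0 else 1.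
pose hi (u v : G) : R := if u == v then 0 else 1.
have lohi u v : lo u v <= hi u v.
  by rewrite /lo /hi; case: eqP => //= _; case: ifP.
pose lov u : 'rV[R]_#|G| := \row_i lo u (enum_val i).
pose hiv u : 'rV[R]_#|G| := \row_i hi u (enum_val i).
exists (fun u => [set x : 'rV[R]_#|G| |
                   forall i, x 0 i \in `[lov u 0 i, hiv u 0 i]]).
split=> [u|u v].
  by exists (lov u), (hiv u); split=> // i; rewrite !mxE.
rewrite /= /inter_adj; have [->|uv] := eqVneq u v; first by rewrite adj_irr.
apply/idP/asboolP => /= [Guv|[x [/= xu xv]]]; last first.
  apply: contraT => nGuv.
  move: (xu (enum_rank u)) (xv (enum_rank u)).
  rewrite !mxE enum_rankK !in_itv /= /lo /hi eqxx (eq_sym v) (negbTE uv).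
  rewrite (negbTE nGuv) /= => /andP[_ x0] /andP[x1 _].
  by have := le_trans x1 x0; rewrite ler10.
exists (\row_i Num.max (lo u (enum_val i)) (lo v (enum_val i))).
split=> /= i; rewrite !mxE in_itv /= le_max lexx ?orbT //= ge_max lohi ?andbT /=.
  rewrite /lo /hi; case: (u =P enum_val i) => [<-|_]; last by case: ifP.
  by rewrite Guv orbT.
rewrite /lo /hi; case: (v =P enum_val i) => [<-|_]; last by case: ifP.
by rewrite adj_sym Guv orbT.
Qed.

Definition boxicity (R : realType) (G : sgraph) : nat :=
  ex_minn (box_representable_ex R G).

(* The convention box(K_n) = 0 is the case [d = 0] of [box_representable]. *)
Lemma boxicity_eq0 (R : realType) (G : sgraph) :
  boxicity R G = 0%N <-> forall u v : G, u != v -> adj u v.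
Proof.
rewrite /boxicity; case: ex_minnP => d /asboolP rd dmin; split=> [d0|Gc].
  move: rd; rewrite d0 => -[B [Bbox eB]] u v uv.
  rewrite eB /= /inter_adj uv; apply/asboolP; exists 0.
  by split; [have [a [b [_ ->]]] := Bbox u | have [a [b [_ ->]]] := Bbox v];
    case.
apply/eqP; rewrite -leqn0; apply/dmin/asboolP.
exists (fun=> [set: 'rV[R]_0]); split=> [u|u v].
  exists 0, 0; split; first by case.
  by apply/esym; rewrite -subTset => x _ [].
rewrite /= /inter_adj; have [->|uv] := eqVneq u v; first by rewrite adj_irr.
by rewrite Gc //=; apply/esym/asboolP; exists 0.
Qed.

Definition graph_agreeable23 (G : sgraph) : Prop :=
  forall x y z : G, x != y -> x != z -> y != z ->
    [|| adj x y, adj x z | adj y z].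

Definition clique (G : sgraph) (K : {set G}) : bool :=
  [forall x in K, forall y in K, (x != y) ==> adj x y].

Definition clique_number (G : sgraph) : nat :=
  \max_(K : {set G} | clique K) #|K|.

Definition graph_class (R : realType) (d r : nat) (G : sgraph) : Prop :=
  [/\ graph_agreeable23 G, (boxicity R G <= d)%N & (clique_number G <= r)%N].

Definition clique_ratios (R : realType) (r d : nat) : set R :=
  [set q | exists G : sgraph, [/\ graph_class R d r G, (0 < #|G|)%N &
    q = (clique_number G)%:R / #|G|%:R]].

Arguments clique_ratios : clear implicits.

(* For [0 < r] this infimum is a minimum: see [rho_min] below. *)
Definition rho (R : realType) (r d : nat) : R := inf (clique_ratios R r d).

Lemma cliqueP (G : sgraph) (K : {set G}) :
  reflect (forall x y, x \in K -> y \in K -> x != y -> adj x y) (clique K).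
Proof.
apply: (iffP forall_inP) => [cK x y xK yK|cK x xK].
  by move/forall_inP: (cK x xK) => /(_ y yK) /implyP.
by apply/forall_inP => y yK; apply/implyP; exact: cK.
Qed.

Lemma leq_clique_number (G : sgraph) (K : {set G}) :
  clique K -> (#|K| <= clique_number G)%N.
Proof. by move=> cK; rewrite /clique_number (bigD1 K) //= leq_maxl. Qed.

Lemma agreeable23_card (r : nat) (G : sgraph) :
  graph_agreeable23 G -> (clique_number G <= r)%N -> (#|G| <= r + r * r)%N.
Proof.
move=> Gag Gr.
have c0 : clique (finset.set0 : {set G}).
  by apply/cliqueP => x y; rewrite finset.inE.
have [K cK KE] : {K : {set G} | clique K & clique_number G = #|K|}.
  by apply: eq_bigmax_cond; apply/card_gt0P; exists finset.set0.
have Kr : (#|K| <= r)%N by rewrite -KE.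
pose N (k : G) : {set G} := [set v | (v != k) && ~~ adj k v]%SET.
have Nr k : (#|N k| <= r)%N.
  apply: leq_trans Gr; apply: leq_clique_number; apply/cliqueP => x y.
  rewrite !finset.inE => /andP[xk /negbTE nx] /andP[yk /negbTE ny] xy.
  by have := Gag k x y; rewrite nx ny !(eq_sym k) => /(_ xk yk xy).
have cover : [set: G]%SET \subset (K :|: \bigcup_(k in K) N k)%SET.
  apply/fintype.subsetP => v _; rewrite finset.in_setU.
  have [//|vK] /= := boolP (v \in K); apply: contraT => nv.
  have adjv k : k \in K -> adj k v.
    move=> kK; apply: contraNT nv => nkv; apply/finset.bigcupP; exists k => //.
    by rewrite finset.inE nkv andbT; apply: contraNneq vK => ->.
  have : clique (v |: K)%SET.
    apply/cliqueP => x y /finset.setU1P[->|xK] /finset.setU1P[->|yK].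
    - by rewrite eqxx.
    - by move=> _; rewrite adj_sym adjv.
    - by move=> _; rewrite adjv.
    - by move/cliqueP: cK; apply.
  by move/leq_clique_number; rewrite KE cardsU1 vK add1n ltnn.
rewrite -cardsT; apply: leq_trans (subset_leq_card cover) _.
apply: leq_trans (leq_card_setU _ _) _; apply: leq_add => //.
apply: (@leq_trans (\sum_(k in K) r)%N); last first.
  by rewrite sum_nat_const leq_mul2r Kr orbT.
elim/big_rec2: _ => [|k m U _ Um]; first by rewrite cards0.
by apply: leq_trans (leq_card_setU _ _) _; apply: leq_add.
Qed.

Lemma rho_min (R : realType) (r d : nat) : (0 < r)%N ->
  clique_ratios R r d (rho R r d) /\
  forall q, clique_ratios R r d q -> rho R r d <= q.
Proof.
move=> r0.
pose N := (r + r * r)%N.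
pose P (p : 'I_r.+1 * 'I_N.+1) := `[< exists G : sgraph,
  [/\ graph_class R d r G, (0 < #|G|)%N, clique_number G = p.1 :> nat
    & #|G| = p.2 :> nat] >].
have PG (G : sgraph) : graph_class R d r G -> (0 < #|G|)%N ->
    exists2 p, P p & clique_number G = p.1 :> nat /\ #|G| = p.2 :> nat.
  move=> Gc G0; have [Gag Gbox Gr] := Gc.
  exists (inord (clique_number G), inord #|G|);
    last by rewrite /= !inordK // ltnS agreeable23_card.
  apply/asboolP; exists G; split=> //=; rewrite inordK // ltnS.
  exact: agreeable23_card.
have [p0 Pp0 _] : exists2 p, P p & True.
  have e0s : symmetric (fun _ _ : unit => false) by [].
  have e0i : irreflexive (fun _ _ : unit => false) by [].
  have [||p Pp _] := PG (SGraph e0s e0i); [|by rewrite card_unit|by exists p].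
  split; first by case=> -[].
    rewrite (_ : boxicity _ _ = 0)%N //; apply/boxicity_eq0.
    by case=> -[]; rewrite eqxx.
  apply/bigmax_leqP => K _; apply: leq_trans (max_card _) _.
  by rewrite card_unit.
pose f (p : 'I_r.+1 * 'I_N.+1) : R := (p.1 : nat)%:R / (p.2 : nat)%:R.
have [p Pp pmin] := @Order.TotalTheory.arg_minP _ _ _ p0 P f Pp0.
have fp : clique_ratios R r d (f p).
  by move/asboolP: Pp => [G [? ? e1 e2]]; exists G; split=> //; rewrite e1 e2.
have lbp q : clique_ratios R r d q -> f p <= q.
  move=> [G [Gc G0 ->]]; have [p' Pp' [-> ->]] := PG G Gc G0.
  exact: pmin.
suff -> : rho R r d = f p by [].
apply/le_anti/andP; split.
  by apply: ge_inf => //; exists (f p).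
by apply: lb_le_inf => //; exists (f p).
Qed.

(* Main.v *)
(** Let [r] be the largest number of boxes with a common point. Fix a
    direction and let [A] be the box whose upper end in that direction is
    smallest. The boxes that miss [A] pairwise intersect by agreeability, so by
    the Helly property of boxes there are at most [r] of them. The boxes that
    meet [A] all contain the upper end of [A] in the chosen direction, so that
    direction no longer matters for them. Treating the [d] directions one after
    the other gives [n <= (d + 1) * r], and [d + 1 <= 2 * d]. *)
Require Import Defs.
From mathcomp Require Import all_boot all_order all_algebra.
From mathcomp Require Import all_classical all_reals.

Import Order.TTheory GRing.Theory Num.Theory.

Local Open Scope classical_set_scope.
Local Open Scope ring_scope.

(** Intersection of boxes is read off their lower corners [a] and upper corners [b], so the counting
    argument needs only a total order and a boolean test. *)
Definition corners_meet {disp : Order.disp_t} {T : orderType disp} {I : Type}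
    {K : finType} (a b : I -> K -> T) (i j : I) : bool :=
  [forall k, (a i k <= b j k)%O && (a j k <= b i k)%O].

Lemma card_le_of_corners_meet {disp : Order.disp_t} {T : orderType disp}
    {I K : finType} (a b : I -> K -> T) (r : nat) :
    (forall i k, a i k <= b i k)%O ->
    (forall i j l, i != j -> i != l -> j != l ->
      [|| corners_meet a b i j, corners_meet a b i l
        | corners_meet a b j l]) ->
    (forall S : {set I},
      {in S &, forall i j, corners_meet a b i j} -> (#|S| <= r)%N) ->
  (#|I| <= #|K|.+1 * r)%N.
Proof.
move=> ab agr cliquer.
have meetxx i : corners_meet a b i i by apply/forallP => k; rewrite !ab.
(* [D] holds the directions still to be treated; in every other direction any two boxes of [V]
   already overlap. *)
suff main m (D : {set K}) (V : {set I}) : #|D| = m ->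
    (forall k, k \notin D -> {in V &, forall i j, a i k <= b j k}%O) ->
    (#|V| <= m.+1 * r)%N.
  by rewrite -!cardsT; apply: main => // k; rewrite finset.inE.
elim: m D V => [|m IHm] D V Dm DV.
  rewrite mul1n; apply: cliquer => i j iV jV; apply/forallP => k.
  by rewrite !DV // (cards0_eq Dm) finset.inE.
have [->|[i0 i0V]] := set_0Vmem V; first by rewrite cards0.
have [k kD] : exists k, k \in D by apply/card_gt0P; rewrite Dm.
have [A AV Amin] := @Order.TotalTheory.arg_minP _ _ _ i0
  [in V] (fun i => b i k) i0V.
pose M := [set i in V | corners_meet a b A i]%SET.
(* The boxes of [V] outside [M] miss [A], so they account for the summand [r]; those in [M] go to
   the induction hypothesis with [k] removed from [D]. *)
rewrite -(cardsID M V) mulSn addnC leq_add //.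
  apply: cliquer => i j; rewrite !finset.inE.
  move=> /andP[niA iV] /andP[njA jV]; move: niA njA; rewrite iV jV /=.
  move=> niA njA; have [->//|ij] := eqVneq i j.
  have Ai : A != i by apply: contraNneq niA => <-.
  have Aj : A != j by apply: contraNneq njA => <-.
  by have := agr _ _ _ Ai Aj ij; rewrite (negbTE niA) (negbTE njA).
apply: (IHm (D :\ k)%SET); first by move: Dm; rewrite (cardsD1 k) kD => -[].
move=> l lDk i j; rewrite !finset.inE.
move=> /andP[iV /andP[_ Ai]] /andP[jV _].
have [->|lk] := eqVneq l k; last first.
  by apply: DV => //; move: lDk; rewrite !finset.inE lk.
(* The upper end of [A] separates the two bounds: [a i k <= b A k] as [i] meets [A], and
   [b A k <= b j k] by minimality. *)
have /andP[_ aib] := forallP Ai k.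
exact: le_trans aib (Amin j jV).
Qed.

(** Helly property of boxes: in each coordinate, the largest lower end over [S] lies below every
    upper end. *)
Lemma corners_meet_common {R : realType} {d : nat} {I : finType}
    {a b : I -> 'I_d -> R} {S : {set I}} :
    {in S &, forall i j, corners_meet a b i j} ->
  exists x : 'rV[R]_d, forall i, i \in S -> forall k,
    x 0 k \in `[a i k, b i k].
Proof.
move=> Smeet; have [->|[i0 i0S]] := set_0Vmem S.
  by exists 0 => i; rewrite finset.inE.
exists (\row_k a [arg max_(i > i0 in S) a i k]%O k) => i iS k.
rewrite mxE in_itv /=; case: Order.TotalTheory.arg_maxP => // j jS jmax.
by apply/andP; split; [exact: jmax | have /andP[] := forallP (Smeet j i jS iS) k].
Qed.

Lemma card_le_agreement_number {R : realType} {d : nat} {I : finType}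
    (B : I -> set 'rV[R]_d) :
    box_arrangement B -> arrangement_agreeable23 B ->
  (#|I| <= d.+1 * agreement_number B)%N.
Proof.
move=> /choice[a /choice[b boxB]] agrB.
pose lo i k := a i 0 k; pose hi i k := b i 0 k.
have meetP i j : B i `&` B j !=set0 -> corners_meet lo hi i j.
  have [[_ ->] [_ ->]] := (boxB i, boxB j).
  move=> [x [/= xi xj]]; apply/forallP => k; move: (xi k) (xj k).
  rewrite !in_itv /= => /andP[aix xbi] /andP[ajx xbj].
  by rewrite (le_trans aix xbj) (le_trans ajx xbi).
rewrite -{1}(card_ord d); apply: (@card_le_of_corners_meet _ _ _ _ lo hi).
- by move=> i k; have [aib _] := boxB i; exact: aib.
- by move=> i j l ij il jl; apply/or3P; case: (agrB i j l ij il jl) => /meetP;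
    [apply: Or31|apply: Or32|apply: Or33].
move=> S /corners_meet_common[x xS].
rewrite /agreement_number (bigD1 S) ?leq_maxl //=; apply/asboolP.
by exists x => i iS; have [_ ->] := boxB i => k; exact: xS.
Qed.

(** The point [x0] makes the empty family admissible, so the maximum is attained by some family with
    a common point. *)
Lemma agreement_number_depth {T : Type} {I : finType} (x0 : T)
    (B : I -> set T) : exists x, (agreement_number B <= point_depth B x)%N.
Proof.
have [|S /asboolP[x xS] SE] := @eq_bigmax_cond {set I}
    [pred S : {set I} | `[< exists x, forall i, i \in S -> B i x >]]
    (fun S => #|S|).
  apply/card_gt0P; exists finset.set0; apply/asboolP.
  by exists x0 => i; rewrite finset.inE.
exists x; rewrite /agreement_number SE; apply: subset_leq_card.
by apply/fintype.subsetP => i /xS Bix; exact: mem_set.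
Qed.

Lemma agreement_number_clique {T : Type} {G : sgraph} (B : G -> set T) :
    @adj G =2 @adj (intersection_graph B) ->
  (agreement_number B <= clique_number G)%N.
Proof.
move=> adjE; apply/bigmax_leqP => S /asboolP[x xS].
apply: leq_clique_number; apply/cliqueP => u v uS vS uv.
by rewrite adjE /= /inter_adj uv; apply/asboolP; exists x; split; exact: xS.
Qed.

Lemma card_le_clique_number (R : realType) {G : sgraph} :
    graph_agreeable23 G -> (#|G| <= (boxicity R G).+1 * clique_number G)%N.
Proof.
rewrite /boxicity; case: ex_minnP => d /asboolP[B [boxB adjE]] _ agrG.
have adjP u v : adj u v -> B u `&` B v !=set0.
  by rewrite adjE => /andP[_ /asboolP].
have agrB : arrangement_agreeable23 B.
  by move=> u v w uv uw vw; case/or3P: (agrG u v w uv uw vw) => /adjP;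
    [apply: Or31|apply: Or32|apply: Or33].
apply: leq_trans (card_le_agreement_number B boxB agrB) _.
by rewrite leq_mul2l agreement_number_clique ?orbT.
Qed.

Theorem theorem1p1 (R : realType) :
  (forall (d n : nat) (B : 'I_n -> set 'rV[R]_d),
     (1 <= d)%N -> (1 <= n)%N ->
     box_arrangement B -> arrangement_agreeable23 B ->
     (exists x : 'rV[R]_d, n%:R / (2 * d)%:R <= (point_depth B x)%:R :> R) /\
     (2 * d)%:R^-1 <= agreement_proportion B) /\
  (forall r d : nat, (1 <= r)%N -> (1 <= d)%N ->
     1 / (2 * d)%:R <= rho R r d).
Proof.
(* Used with [m] equal to [d] for boxes and to the boxicity for graphs. *)
have le2d m d : (1 <= d)%N -> (m <= d)%N -> (m.+1 <= 2 * d)%N.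
  by move=> d1 md; rewrite mul2n -addnn -add1n leq_add.
have ratio (n d w : nat) : (1 <= d)%N -> (1 <= n)%N -> (n <= 2 * d * w)%N ->
    (2 * d)%:R^-1 <= w%:R / n%:R :> R.
  move=> d1 n1 nw; rewrite ler_pdivlMr ?ltr0n //.
  by rewrite ler_pdivrMl ?ltr0n ?muln_gt0 // -natrM ler_nat.
split=> [d n B d1 n1 boxB agrB|r d r1 d1].
  have nB : (n <= 2 * d * agreement_number B)%N.
    rewrite -{1}(card_ord n).
    apply: leq_trans (card_le_agreement_number B boxB agrB) _.
    by rewrite leq_mul2r le2d ?orbT.
  split; last by rewrite /agreement_proportion card_ord; exact: ratio.
  have [x Bx] := agreement_number_depth 0 B; exists x.
  rewrite ler_pdivrMr ?ltr0n ?muln_gt0 // -natrM ler_nat mulnC.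
  by apply: leq_trans nB _; rewrite leq_mul2l Bx orbT.
(* The infimum is attained, so it suffices to bound the ratio of a single graph [G]. *)
have [[G [[agrG boxG _] G0 ->]] _] := rho_min R d r1.
rewrite div1r; apply: ratio => //.
apply: leq_trans (card_le_clique_number R agrG) _.
by rewrite leq_mul2r le2d ?orbT.
Qed.
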